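(* Let $T$ be a $1$-semi-equational theory. Then $T$ has almost-linear Zarankiewicz bounds for its definable bipartite graphs, and $T$ does not locally trace-define an infinite domain.
   Context: Semi-equations. Let $M$ be a structure and $k\geq 2$. A partitioned formula $\phi(x;y)$ is a $(k,1)$-semi-equation in $M$ if, whenever $b_1,\ldots,b_k\in M^{|y|}$ and $M\models\exists x\bigwedge_{j=1}^k\phi(x;b_j)$, there are distinct $i,j\in\{1,\ldots,k\}$ such that $M\models\forall x(\phi(x;b_i)\rightarrow\phi(x;b_j))$. It is a $(k,1)$-semi-equation for a theory $T$ if it is one in every model of $T$. A theory $T$ is $1$-semi-equational if every partitioned formula is equivalent, modulo $T$, to a finite Boolean combination of $(k,1)$-semi-equations (with respect to the same partition), where $k$ may depend on the formula. Almost-linear Zarankiewicz bounds. $T$ has almost-linear Zarankiewicz bounds for its definable bipartite graphs if for every formula $\varphi(x;y)$ and every integer $t\geq 2$ there are constants $C,c\geq 0$ such that for every $M\models T$ and all finite $V\subseteq M^{|x|}$, $W\subseteq M^{|y|}$ with $n=|V|+|W|$: if $E=\{(a,b)\in V\times W: M\models\varphi(a;b)\}$ contains no product $A\times A'$ with $A\subseteq V$, $A'\subseteq W$, $|A|=|A'|=t$, then $|E|\leq Cn(1+\log(1+n))^c$. (In particular, $|E|=O_\varepsilon(n^{1+\varepsilon})$ for every $\varepsilon>0$.) Local trace definability. A structure $M$ locally trace-defines a structure $O$ if every finite trace of a relation definable in $O$ can be realized as the trace of a definable relation of $M$; precisely, for every $m\geq 1$ and every relation $R\subseteq O^m$ definable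 in $O$ there are $p\geq 1$ and a relation $S\subseteq (M^p)^m$ definable in $M$ such that for every finite $A\subseteq O$ there is a map $f\colon A\to M^p$ with $(a_1,\ldots,a_m)\in R\iff (f(a_1),\ldots,f(a_m))\in S$ for all $a_1,\ldots,a_m\in A$. A theory $T$ locally trace-defines $O$ if some model of $T$ does. A domain is an integral domain, regarded as a structure in the language of rings. *)

(* Defs.v *)
From HB Require Import structures.
From mathcomp Require Import all_boot all_order all_algebra.
From mathcomp Require Import all_classical all_reals exp.
Set Implicit Arguments.
Unset Strict Implicit.
Unset Printing Implicit Defensive.
Import Order.TTheory GRing.Theory Num.Theory.
Local Open Scope classical_set_scope.
Local Open Scope card_scope.
Local Open Scope ring_scope.

Record language : Type := Language {
  fsym : Type;
  farity : fsym -> nat;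
  rsym : Type;
  rarity : rsym -> nat }.

Section Syntax.
Variable L : language.

Inductive term (X : Type) : Type :=
| Var of X
| App (f : fsym L) of ('I_(farity f) -> term X).

(* Formulas with free variables in X: a quantifier binds the variable None,
   its body having free variables in [option X]. *)
Inductive formula (X : Type) : Type :=
| Bot
| Eq of term X & term X
| Rel (r : rsym L) of ('I_(rarity r) -> term X)
| Not of formula X
| And of formula X & formula X
| Or of formula X & formula X
| Imp of formula X & formula X
| All of formula (option X)
| Ex of formula (option X).

Definition pformula (p q : nat) := formula ('I_p + 'I_q)%type.
Definition sentence := formula void.
Definition theory := set sentence.

(* Finite Boolean combinations of formulas taken from P. *)
Inductive bool_comb (X : Type) (P : set (formula X)) : formula X -> Prop :=
| bc_base phi of P phi : bool_comb P phi
| bc_bot : bool_comb P (Bot X)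
| bc_not phi of bool_comb P phi : bool_comb P (Not phi)
| bc_and phi psi of bool_comb P phi & bool_comb P psi :
    bool_comb P (And phi psi)
| bc_or phi psi of bool_comb P phi & bool_comb P psi :
    bool_comb P (Or phi psi)
| bc_imp phi psi of bool_comb P phi & bool_comb P psi :
    bool_comb P (Imp phi psi).

Record structure : Type := Structure {
  carrier :> Type;
  finterp : forall f : fsym L, ('I_(farity f) -> carrier) -> carrier;
  rinterp : forall r : rsym L, ('I_(rarity r) -> carrier) -> Prop;
  carrier_nonempty : inhabited carrier }.

End Syntax.

Section Semantics.
Variables (L : language) (M : structure L).

Fixpoint eval (X : Type) (v : X -> M) (t : term L X) : M :=
  match t with
  | Var x => v x
  | App f ts => finterp (fun i => eval v (ts i))
  end.

Definition extend (X : Type) (v : X -> M) (a : M) (o : option X) : M :=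
  if o is Some x then v x else a.

Fixpoint sat (X : Type) (v : X -> M) (phi : formula L X) {struct phi} : Prop :=
  match phi with
  | Bot => False
  | Eq t u => eval v t = eval v u
  | Rel r ts => rinterp (fun i => eval v (ts i))
  | Not f => ~ sat v f
  | And f g => sat v f /\ sat v g
  | Or f g => sat v f \/ sat v g
  | Imp f g => sat v f -> sat v g
  | All f => forall a : M, sat (extend v a) f
  | Ex f => exists a : M, sat (extend v a) f
  end.

Definition join (X Y : Type) (a : X -> M) (b : Y -> M) (z : X + Y) : M :=
  match z with inl x => a x | inr y => b y end.

Definition psat (X Y : Type) (phi : formula L (X + Y)%type)
  (a : X -> M) (b : Y -> M) : Prop := sat (join a b) phi.

Definition models (T : theory L) : Prop :=
  forall s : sentence L, T s -> sat (fun x : void => match x with end) s.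

(* M |= exists x, /\_j phi(x; b_j) implies M |= forall x, phi(x; b_i) ->
   phi(x; b_j) for distinct indices i, j; the b_j need not be distinct. *)
Definition semi_equation_in (k p q : nat) (phi : pformula L p q) : Prop :=
  (2 <= k)%N /\
  forall b : 'I_k -> 'I_q -> M,
    (exists a : 'I_p -> M, forall j : 'I_k, psat phi a (b j)) ->
    exists i j : 'I_k, i <> j /\
      forall a : 'I_p -> M, psat phi a (b i) -> psat phi a (b j).

(* Definability is with parameters (here c), as usual in model theory. *)
Definition definable (I : Type) (S : set (I -> M)) : Prop :=
  exists (r : nat) (phi : formula L (I + 'I_r)%type) (c : 'I_r -> M),
    S = [set a | psat phi a c].

(* A subset of (M^p)^m is definable when it is so as a subset of M^(m * p). *)
Definition definable_blocks (m p : nat) (S : set ('I_m -> 'I_p -> M)) : Prop :=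
  definable [set a : 'I_m * 'I_p -> M | S (fun i j => a (i, j))].

End Semantics.

Definition semi_equation (L : language) (T : theory L) (k p q : nat)
    (phi : pformula L p q) : Prop :=
  forall M : structure L, models M T -> semi_equation_in M k phi.

Definition equivalent_mod (L : language) (T : theory L) (X : Type)
    (phi psi : formula L X) : Prop :=
  forall M : structure L, models M T ->
    forall v : X -> M, sat v phi <-> sat v psi.

Definition one_semi_equational (L : language) (T : theory L) : Prop :=
  forall (p q : nat) (phi : pformula L p q),
    exists (k : nat) (psi : pformula L p q),
      [/\ (2 <= k)%N,
          bool_comb [set theta : pformula L p q | semi_equation T k theta] psi
        & equivalent_mod T phi psi].

Definition bip_edges (L : language) (M : structure L) (p q : nat)
    (phi : pformula L p q) (V : set ('I_p -> M)) (W : set ('I_q -> M)) :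
    set (('I_p -> M) * ('I_q -> M)) :=
  [set e | [/\ V e.1, W e.2 & psat phi e.1 e.2]].

Definition has_biclique (A B : Type) (E : set (A * B)) (V : set A) (W : set B)
    (t : nat) : Prop :=
  exists (A1 : set A) (B1 : set B),
    [/\ A1 `<=` V, B1 `<=` W, A1 #= `I_t, B1 #= `I_t & A1 `*` B1 `<=` E].

(* The cardinalities |V|, |W|, |E| are v, w, e. *)
Definition almost_linear_zarankiewicz (R : realType) (L : language)
    (T : theory L) : Prop :=
  forall (p q : nat) (phi : pformula L p q) (t : nat), (2 <= t)%N ->
    exists C c : R, [/\ 0 <= C, 0 <= c &
      forall M : structure L, models M T ->
      forall (V : set ('I_p -> M)) (W : set ('I_q -> M)) (v w e : nat),
        V #= `I_v -> W #= `I_w -> bip_edges phi V W #= `I_e ->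
        ~ has_biclique (bip_edges phi V W) V W t ->
        let n : R := (v + w)%:R in
        e%:R <= C * n * (1 + ln (1 + n)) `^ c].

Definition locally_trace_defines_in (L L' : language) (M : structure L)
    (O : structure L') : Prop :=
  forall (m : nat) (R : set ('I_m -> O)), (1 <= m)%N -> definable R ->
    exists (p : nat) (S : set ('I_m -> 'I_p -> M)),
      [/\ (1 <= p)%N, definable_blocks S &
        forall A : set O, finite_set A ->
          exists f : A -> 'I_p -> M,
            forall a : 'I_m -> A,
              R (fun i => val (a i)) <-> S (fun i => f (a i))].

Definition locally_trace_defines (L L' : language) (T : theory L)
    (O : structure L') : Prop :=
  exists M : structure L, models M T /\ locally_trace_defines_in M O.

Variant ring_fsym := Rzero | Rone | Ropp | Radd | Rmul.

Definition ring_farity (f : ring_fsym) : nat :=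
  match f with Rzero | Rone => 0 | Ropp => 1 | Radd | Rmul => 2 end%N.

Definition ring_language : language :=
  @Language ring_fsym ring_farity void (fun r => match r with end).

Definition ring_finterp (D : idomainType) (f : ring_fsym) :
    ('I_(ring_farity f) -> D) -> D :=
  match f return ('I_(ring_farity f) -> D) -> D with
  | Rzero => fun=> 0
  | Rone => fun=> 1
  | Ropp => fun a => - a ord0
  | Radd => fun a => a ord0 + a ord_max
  | Rmul => fun a => a ord0 * a ord_max
  end.

Definition ring_structure (D : idomainType) : structure ring_language :=
  @Structure ring_language D (@ring_finterp D)
    (fun r => match r with end) (inhabits (0 : D)).

(* Main.v *)
Require Import Defs.
From HB Require Import structures.
From mathcomp Require Import all_boot all_order all_algebra.
From mathcomp Require Import zify.
Set Implicit Arguments.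
Unset Strict Implicit.
Unset Printing Implicit Defensive.

(* A relation [e] between finite sets is tame when both [e] and its complement
   are unions of bicliques such that every vertex lies in few (polylogarithmically
   many) of them. Tameness is stable under Boolean combinations, and a K_{t,t}-free
   union of such bicliques has almost linearly many edges, since each biclique has
   a side smaller than [t]. So it suffices to treat a semi-equation, that is, a
   family of sets in which the antichains through any given point are bounded.
   Split the family into logarithmically many levels according to the dyadic size
   of the sets. Inside a level, a set contains boundedly many members of any
   antichain (double counting), so assigning to each set a minimal set below it,
   and then a chain of a Dilworth decomposition of the sets above the latter,
   partitions the level into chains of which each point meets boundedly many.
   Membership in a chain is a comparison of natural numbers, which is tame by
   binary search.

   An infinite domain contains, for every [d], a set X of 2^d elements (the subset
   sums of d generic elements) and, by a pigeonhole argument, sets B, B' with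
   X X + B inside B', |B'| <= 2 |B| and log |B| polynomial in d. The incidences
   between the points of X * B' and the lines y = a x + b with (a, b) in X * B
   are K_{2,2}-free but too many for an almost linear bound. *)

(** * Relations covered by few bicliques *)

(** Each key [i] stands for the biclique whose sides are the [a] with [i] in [s a] and the [b] with
    [i] in [t b]. The bound [d] is on the keys at each vertex, not on the number of bicliques. *)
Definition bicover (A B : Type) (d : nat) (e : A -> B -> bool) : Prop :=
  exists (I : eqType) (s : A -> seq I) (t : B -> seq I),
    [/\ forall a, size (s a) <= d, forall b, size (t b) <= d &
      forall a b, e a b = has [in t b] (s a)].

Section Bicover.
Variables A B : Type.
Implicit Types (e : A -> B -> bool) (d : nat).

Lemma bicover_ext d e e' : e =2 e' -> bicover d e -> bicover d e'.
Proof.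
move=> ee' [I [s [t [hs ht he]]]]; exists I, s, t.
by split=> // a b; rewrite -ee'.
Qed.

Lemma bicover_le d d' e : d <= d' -> bicover d e -> bicover d' e.
Proof.
move=> dd' [I [s [t [hs ht he]]]]; exists I, s, t.
by split=> // a; apply: leq_trans dd'.
Qed.

Lemma bicover_eq (K : eqType) (f : A -> K) (g : B -> K) :
  bicover 1 (fun a b => f a == g b).
Proof.
exists K, (fun a => [:: f a]), (fun b => [:: g b]).
by split=> // a b; rewrite /= orbF inE.
Qed.

Lemma bicover_left (P : A -> bool) : bicover 1 (fun a (_ : B) => P a).
Proof. by apply: bicover_ext (bicover_eq P (fun=> true)) => a b; case: (P a). Qed.

Lemma bicover_right (P : B -> bool) : bicover 1 (fun (_ : A) => P).
Proof. by apply: bicover_ext (bicover_eq (fun=> true) P) => a b; case: (P b). Qed.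

Lemma bicover_or d d' e e' : bicover d e -> bicover d' e' ->
  bicover (d + d') (fun a b => e a b || e' a b).
Proof.
move=> [I [s [t [hs ht he]]]] [J [s' [t' [hs' ht' he']]]].
exists (I + J)%type, (fun a => map inl (s a) ++ map inr (s' a)),
  (fun b => map inl (t b) ++ map inr (t' b)).
split=> [a|b|a b]; try by rewrite size_cat !size_map leq_add.
rewrite he he' has_cat !has_map; congr orb; apply: eq_has => i /=.
  rewrite mem_cat mem_map; last by move=> x y [].
  by rewrite orbC; case: mapP => [[]|].
rewrite mem_cat orbC mem_map; last by move=> x y [].
by rewrite orbC; case: mapP => [[]|].
Qed.

(** The intersection of two bicliques is a biclique, keyed by the pair of their keys. *)
Lemma bicover_and d d' e e' : bicover d e -> bicover d' e' ->
  bicover (d * d') (fun a b => e a b && e' a b).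
Proof.
move=> [I [s [t [hs ht he]]]] [J [s' [t' [hs' ht' he']]]].
exists (I * J)%type, (fun a => allpairs pair (s a) (s' a)),
  (fun b => allpairs pair (t b) (t' b)).
split=> [a|b|a b]; try by rewrite size_allpairs leq_mul.
rewrite he he'; apply/andP/hasP.
  move=> [/hasP[i is_ it] /hasP[j js jt]].
  exists (i, j); first exact: allpairs_f.
  exact: allpairs_f.
move=> [[i j] /allpairsP[[x y] /= [xs ys [-> ->]]]].
move=> /allpairsP[[x' y'] /= [xt yt [ex ey]]]; split; apply/hasP.
  by exists x => //; rewrite ex.
by exists y => //; rewrite ey.
Qed.

(* The keys of [x] are the nodes of the binary tree of height [m] from which
   [x] descends to the left, those of [y] the nodes from which it descends to
   the right. *)
Lemma bicover_ltn m (f : A -> nat) (g : B -> nat) :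
    (forall a, f a < 2 ^ m) -> (forall b, g b < 2 ^ m) ->
  bicover m (fun a b => f a < g b).
Proof.
move=> hf hg; suff: exists s t : nat -> seq (nat * nat),
    [/\ forall x, size (s x) <= m, forall y, size (t y) <= m &
      forall x y, x < 2 ^ m -> y < 2 ^ m -> (x < y) = has [in t y] (s x)].
  case=> s [t [hs ht h]]; exists (nat * nat)%type, (s \o f), (t \o g).
  by split=> //= a b; rewrite h.
elim: m {f g hf hg} => [|m [s [t [hs ht h]]]].
  by exists (fun=> [::]), (fun=> [::]); split=> // -[|x] [|y].
pose up (i : nat * nat) := (i.1.+1, i.2).
have upI : injective up by move=> [i j] [i' j'] [-> ->].
exists (fun x => nseq (~~ odd x) (0, x./2) ++ map up (s x./2)),
  (fun y => nseq (odd y) (0, y./2) ++ map up (t y./2)).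
split=> [x|y|x y hx hy].
- by rewrite size_cat size_nseq size_map; have := hs x./2; case: odd => /=; lia.
- by rewrite size_cat size_nseq size_map; have := ht y./2; case: odd => /=; lia.
rewrite expnS in hx hy.
have ux i n : (up i \in nseq n (0, y./2)) = false by rewrite mem_nseq andbF.
have -> : (x < y) = (x./2 < y./2) || [&& ~~ odd x, odd y & x./2 == y./2] by lia.
rewrite h; try lia; rewrite has_cat has_map orbC; congr orb; last first.
  by apply: eq_has => i /=; rewrite mem_cat ux mem_map.
rewrite has_nseq /= mem_cat mem_nseq lt0b xpair_eqE /=.
have -> : ((0, x./2) \in map up (t y./2)) = false by apply/mapP => -[].
by rewrite orbF; case: (odd x); case: (odd y).
Qed.

Definition tame d e := bicover d e /\ bicover d (fun a b => ~~ e a b).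

Lemma tame_ext d e e' : e =2 e' -> tame d e -> tame d e'.
Proof.
move=> ee' [h h']; split; first exact: bicover_ext h.
by apply: bicover_ext h' => a b; rewrite ee'.
Qed.

Lemma tame_le d d' e : d <= d' -> tame d e -> tame d' e.
Proof. by move=> dd' [h h']; split; apply: bicover_le dd' _. Qed.

Lemma tame_not d e : tame d e -> tame d (fun a b => ~~ e a b).
Proof. by case=> h h'; split=> //; apply: bicover_ext h => a b; rewrite negbK. Qed.

(** The complement is a union and costs [d + d'] keys, which is at most [d * d'] once both are at
    least 2. *)
Lemma tame_and d d' e e' : 1 < d -> 1 < d' -> tame d e -> tame d' e' ->
  tame (d * d') (fun a b => e a b && e' a b).
Proof.
move=> d1 d1' [h1 h2] [h1' h2']; split; first exact: bicover_and.
apply: bicover_le (bicover_ext _ (bicover_or h2 h2')); first by nia.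
by move=> a b; rewrite negb_and.
Qed.

Lemma tame_or d d' e e' : 1 < d -> 1 < d' -> tame d e -> tame d' e' ->
  tame (d * d') (fun a b => e a b || e' a b).
Proof.
move=> d1 d1' h h'.
apply: tame_ext (tame_not (tame_and d1 d1' (tame_not h) (tame_not h'))) => a b.
by rewrite negb_and !negbK.
Qed.

Lemma tame_left (P : A -> bool) : tame 1 (fun a (_ : B) => P a).
Proof. by split; exact: bicover_left. Qed.

Lemma tame_ltn m (f : A -> nat) (g : B -> nat) :
    (forall a, f a < 2 ^ m) -> (forall b, g b < 2 ^ m) ->
  tame m.+1 (fun a b => f a < g b).
Proof.
move=> hf hg; split; first exact: bicover_le (bicover_ltn hf hg).
(* Reversing the interval below [2 ^ m] turns [g b < f a] into a comparison with the [A] side on the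
   left. *)
have h2 c : c < 2 ^ m -> (2 ^ m).-1 - c < 2 ^ m by lia.
have hl := bicover_ltn (fun a => h2 _ (hf a)) (fun b => h2 _ (hg b)).
have := bicover_or hl (bicover_eq f g); rewrite addn1; apply: bicover_ext => a b.
by have := hf a; have := hg b; lia.
Qed.

Lemma tame_eqn m (f : A -> nat) (g : B -> nat) :
    (forall a, f a < 2 ^ m) -> (forall b, g b < 2 ^ m) ->
  tame (m.+2 * m.+2) (fun a b => f a == g b).
Proof.
move=> hf hg; split; first exact: bicover_le (bicover_eq f g).
have h2 c : c < 2 ^ m -> (2 ^ m).-1 - c < 2 ^ m by lia.
have hl := bicover_ltn (fun a => h2 _ (hf a)) (fun b => h2 _ (hg b)).
apply: bicover_le (bicover_ext _ (bicover_or hl (bicover_ltn hf hg))); first by nia.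
by move=> a b; have := hf a; have := hg b; lia.
Qed.

(** The level depends on [b] alone, so restricting to one level does not multiply the number of
    keys; the [J] levels add up. *)
Lemma bicover_case d J (lev : B -> nat) (e : nat -> A -> B -> bool) :
    (forall b, lev b < J) -> (forall j, bicover d (e j)) ->
  bicover (J * d) (fun a b => e (lev b) a b).
Proof.
move=> hlev he.
suff h n : bicover (n * d) (fun a b => (lev b < n) && e (lev b) a b).
  by apply: bicover_ext (h J) => a b; rewrite hlev.
elim: n => [|n IHn].
  by exists unit, (fun=> [::]), (fun=> [::]); split.
have := bicover_or (bicover_and (bicover_right (fun b => lev b == n)) (he n)) IHn.
rewrite mul1n; apply: bicover_ext => a b.
rewrite (ltnS (lev b)) [lev b <= n]leq_eqVlt; case: (eqVneq (lev b) n) => [->|_] //=.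
by rewrite ltnn orbF.
Qed.

Lemma tame_case d J (lev : B -> nat) (e : nat -> A -> B -> bool) :
    (forall b, lev b < J) -> (forall j, tame d (e j)) ->
  tame (J * d) (fun a b => e (lev b) a b).
Proof.
move=> hlev he; split; first by apply: bicover_case => // j; case: (he j).
by apply: (bicover_case (e := fun j a b => ~~ e j a b)) => // j; case: (he j).
Qed.

Lemma tame_has d r (e : nat -> A -> B -> bool) :
    1 < d -> (forall i, tame d (e i)) ->
  tame (d ^ r.+1) (fun a b => has (fun i => e i a b) (iota 0 r)).
Proof.
move=> d1 he; elim: r => [|r IHr].
  by apply: tame_le (tame_left (fun=> false)); rewrite expn1; lia.
rewrite expnSr; have dr : 1 < d ^ r.+1 by rewrite -{1}(exp1n r.+1) ltn_exp2r.
apply: tame_ext (tame_or dr d1 IHr (he r)) => a b.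
by rewrite -[in RHS]addn1 iotaD has_cat /= orbF add0n.
Qed.

End Bicover.

(** * Edges of relations without large bicliques *)

Lemma card_keys_lt (B : finType) (I : eqType) (Q : I -> {set B}) (n : nat)
    (s : seq I) :
  #|[set b | has (fun i => (b \in Q i) && (#|Q i| <= n)) s]| <= size s * n.
Proof.
elim: s => [|i s IHs] /=.
  by rewrite (_ : [set b | false] = set0) ?cards0 //; apply/setP=> b; rewrite !inE.
rewrite mulSn; set X := [set b | _]; set Y := [set b | _] in IHs.
have -> : X = [set b in Q i | #|Q i| <= n] :|: Y by apply/setP=> b; rewrite !inE.
apply: leq_trans (leq_card_setU _ _) _; apply: leq_add => //.
case: (leqP #|Q i| n) => hi.
  by apply: leq_trans hi; apply/subset_leq_card/subsetP=> b; rewrite inE andbT.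
by rewrite (_ : [set b in _ | _] = set0) ?cards0 //; apply/setP=> b; rewrite !inE andbF.
Qed.

Lemma card_edges (A B : finType) (e : A -> B -> bool) :
  #|[set x : A * B | e x.1 x.2]| = \sum_(a : A) #|[set b | e a b]|.
Proof.
rewrite -sum1_card (eq_bigl (fun x : A * B => e x.1 x.2)) => [|x]; last by rewrite inE.
rewrite -(pair_big_dep xpredT (fun a b => e a b) (fun _ _ => 1)) /=.
by apply: eq_bigr => a _; rewrite -sum1_card; apply: eq_bigl => b; rewrite inE.
Qed.

(** Some side of each biclique has at most [t] elements, as otherwise subsets of size [t] would be
    forbidden. An edge is charged to its endpoint on the opposite side, which has at most [d] keys,
    each giving at most [t] such edges. *)
Lemma zarankiewicz_bicover (A B : finType) (e : A -> B -> bool) (d t : nat) :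
    bicover d e ->
    (forall (X : {set A}) (Y : {set B}), #|X| = t -> #|Y| = t ->
      ~ (forall a b, a \in X -> b \in Y -> e a b)) ->
  #|[set x : A * B | e x.1 x.2]| <= d * t * (#|A| + #|B|).
Proof.
move=> [I [s [u [hs hu he]]]] hK.
pose P i := [set a | i \in s a]; pose Q i := [set b | i \in u b].
have PQ i : (#|P i| <= t) || (#|Q i| <= t).
  case: (leqP #|P i| t) => //= hP; case: (leqP #|Q i| t) => // hQ.
  have [X XP tX] : exists2 X : {set A}, X \subset P i & #|X| = t.
    have: 0 < #|[set X : {set A} | X \subset P i & #|X| == t]|.
      by rewrite cards_draws bin_gt0 ltnW.
    by case/card_gt0P=> X; rewrite inE => /andP[? /eqP]; exists X.
  have [Y YQ tY] : exists2 Y : {set B}, Y \subset Q i & #|Y| = t.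
    have: 0 < #|[set Y : {set B} | Y \subset Q i & #|Y| == t]|.
      by rewrite cards_draws bin_gt0 ltnW.
    by case/card_gt0P=> Y; rewrite inE => /andP[? /eqP]; exists Y.
  have := hK X Y tX tY; case=> a b aX bY.
  rewrite he; apply/hasP; exists i.
    by move/subsetP: XP => /(_ _ aX); rewrite inE.
  by move/subsetP: YQ => /(_ _ bY); rewrite inE.
(* [l] holds the edges charged to their left endpoint, [r] those charged to their right endpoint. *)
pose l a b := has (fun i => (b \in Q i) && (#|Q i| <= t)) (s a).
pose r a b := has (fun i => (a \in P i) && (#|P i| <= t)) (u b).
have sub : [set x : A * B | e x.1 x.2] \subset
    [set x : A * B | l x.1 x.2] :|: [set x : A * B | r x.1 x.2].
  apply/subsetP=> -[a b]; rewrite !inE /= he => /hasP[i ia ib].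
  case/orP: (PQ i) => hi; apply/orP; [right|left]; apply/hasP; exists i => //=;
    by rewrite inE; apply/andP.
apply: leq_trans (subset_leq_card sub) _.
apply: leq_trans (leq_card_setU _ _) _; rewrite mulnDr; apply: leq_add.
  rewrite card_edges [leqRHS]mulnC -sum_nat_const; apply: leq_sum => a _.
  by apply: leq_trans (card_keys_lt _ _ _) _; rewrite leq_mul2r hs orbT.
have -> : #|[set x : A * B | r x.1 x.2]| = #|[set x : B * A | r x.2 x.1]|.
  have swI : injective (fun x : B * A => (x.2, x.1)) by move=> [b a] [b' a'] [-> ->].
  rewrite -(card_imset _ swI); apply: eq_card => -[a b].
  apply/idP/imsetP=> [h|[[b' a'] h [-> ->]]]; rewrite !inE in h *; last by [].
  by exists (b, a); rewrite ?inE.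
rewrite (card_edges (fun b a => r a b)) [leqRHS]mulnC -sum_nat_const.
apply: leq_sum => b _.
by apply: leq_trans (card_keys_lt _ _ _) _; rewrite leq_mul2r hu orbT.
Qed.

(** * Dilworth's theorem *)

Section Dilworth.
Variables (T : finType) (le : rel T).
Hypotheses (le_refl : reflexive le) (le_trans : transitive le).

Definition antichain (X : {set T}) : bool :=
  [forall x in X, forall y in X, le x y ==> (x == y)].

Lemma antichainP (X : {set T}) :
  reflect {in X &, forall x y, le x y -> x = y} (antichain X).
Proof.
apply: (iffP idP) => [h x y xX yX xy|h].
  by move/forall_inP: h => /(_ x xX)/forall_inP/(_ y yX)/implyP/(_ xy)/eqP.
by apply/forall_inP=> x xX; apply/forall_inP=> y yX; apply/implyP=> xy; apply/eqP/h.
Qed.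

Lemma antichainS (X Y : {set T}) : X \subset Y -> antichain Y -> antichain X.
Proof.
by move=> /subsetP XY /antichainP hY; apply/antichainP=> x y /XY xY /XY; apply: hY.
Qed.

Lemma exists_maximal (P : {set T}) x : x \in P ->
  exists2 a, a \in P & {in P, forall y, le a y -> le y a}.
Proof.
elim: {P}_.+1 {-2}P x (ltnSn #|P|) => // n IHn P x hP xP.
case: (boolP [forall y in P, le x y ==> le y x]) => [/forall_inP h|].
  by exists x => // y yP; apply/implyP/h.
rewrite negb_forall => /existsP[y]; rewrite !negb_imply => /and3P[yP xy nyx].
have [||a] := IHn [set z in P | le y z] y.
- rewrite -ltnS; apply: leq_trans hP; rewrite ltnS; apply: proper_card.
  apply/properP; split; first by apply/subsetP=> z; rewrite inE => /andP[].
  by exists x => //; rewrite inE (negbTE nyx) andbF.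
- by rewrite inE yP le_refl.
rewrite inE => /andP[aP ya] ha; exists a => // z zP az.
by apply: ha => //; rewrite inE zP (le_trans ya).
Qed.

(* Galvin's proof: remove a maximal element [a] and decompose the rest. If the
   width did not drop, the largest elements of the chains among those lying in
   some antichain of size [k] form an antichain, so [a] is above one of them, and
   removing the chain formed by [a] and what lies below that element lowers the
   width. *)
Lemma dilworth (k : nat) (P : {set T}) :
    (forall X : {set T}, X \subset P -> antichain X -> #|X| <= k) ->
  exists f : T -> nat, (forall x, x \in P -> f x < k) /\
    {in P &, forall x y, f x = f y -> le x y || le y x}.
Proof.
elim: {P}_.+1 {-2}P k (ltnSn #|P|) => // n IHn P k hn hP.
case: (set_0Vmem P) => [->|[x0 x0P]].
  by exists (fun=> 0); split=> [x|x y]; rewrite inE.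
have [a aP amax] := exists_maximal x0P.
have hQ (Q : {set T}) : Q \subset P -> a \notin Q -> #|Q| < n.
  move=> QP aQ; rewrite -ltnS; apply: leq_trans hn; rewrite ltnS.
  by apply: proper_card; apply/properP; split=> //; exists a.
have PaP : P :\ a \subset P by apply: subsetDl.
have aPa : a \notin P :\ a by rewrite !inE eqxx.
case: (boolP [exists X : {set T}, [&& X \subset P :\ a, antichain X & k <= #|X|]]);
    last first.
  (* Here the width drops: the rest needs only [k.-1] colours, and [a] gets the last one. *)
  rewrite negb_exists => /forallP hX.
  have [|X XP aX|f [fk fc]] := IHn (P :\ a) k.-1; first exact: hQ.
    by have := hX X; rewrite XP aX /= -ltnNge; lia.
  have k0 : 0 < k.
    have := hX set0; rewrite sub0set cards0 (_ : antichain _) /= -?ltnNge //.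
    by apply/antichainP => x y; rewrite inE.
  exists (fun x => if x == a then k.-1 else f x); split=> [x xP|x y xP yP].
    by case: eqVneq => [_|xa]; [lia|have := fk x; rewrite !inE xa xP => /(_ isT); lia].
  case: (eqVneq x a) => [->|xa]; case: (eqVneq y a) => [->|ya]; rewrite ?le_refl //.
  - by have := fk y; rewrite !inE ya yP => /(_ isT); lia.
  - by have := fk x; rewrite !inE xa xP => /(_ isT); lia.
  by apply: fc; rewrite !inE ?xa ?ya.
case/existsP=> X0 /and3P[X0P aX0 kX0].
have [|X XP|f [fk fc]] := IHn (P :\ a) k; first exact: hQ.
  by apply: hP; apply: subset_trans PaP.
pose big (X : {set T}) := [&& X \subset P :\ a, antichain X & #|X| == k].
have bigX0 : big X0.
  by rewrite /big X0P aX0 eqn_leq kX0 hP //; apply: subset_trans PaP.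
(* Comparable elements of an antichain are equal, so [f] is injective on [X]; having [k] elements,
   [X] meets all [k] colours. *)
have big_color X i : big X -> i < k -> exists2 x, x \in X & f x = i.
  move=> /and3P[/subsetP XP /antichainP aX /eqP cX] ik.
  have finj : {in X &, injective f}.
    move=> x y xX yX fxy; case/orP: (fc x y (XP _ xX) (XP _ yX) fxy) => h.
      exact: aX.
    by apply/esym/aX.
  have k0 : 0 < k by lia.
  pose g x := inord (f x) : 'I_k.-1.+1.
  have fk1 x : x \in X -> f x < k.-1.+1 by move=> /XP/fk; lia.
  have ginj : {in X &, injective g}.
    move=> x y xX yX /(congr1 val); rewrite /g /= !inordK ?fk1 //; exact: finj.
  have : inord i \in g @: X.
    have -> : g @: X = setT; last by rewrite inE.
    by apply/eqP; rewrite eqEcard subsetT cardsT card_ord card_in_imset // cX; lia.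
  case/imsetP=> x xX /(congr1 val); rewrite /g /= !inordK ?fk1 //; last lia.
  by move=> ->; exists x.
pose cand (i : nat) := [set x in P :\ a | (f x == i) && [exists X, big X && (x \in X)]].
have hx (i : nat) : exists x, i < k -> x \in cand i /\ {in cand i, forall y, le y x}.
  case: (ltnP i k) => ik; last by exists a.
  have [x xX0 fx] := big_color _ _ bigX0 ik.
  have xc : x \in cand i.
    have /subsetP/(_ _ xX0) xP := X0P.
    by rewrite inE xP fx eqxx; apply/existsP; exists X0; rewrite bigX0.
  have [y yc ymax] := exists_maximal xc; exists y => _; split=> // z zc.
  have [yP fy] : y \in P :\ a /\ f y = i by move: yc; rewrite inE => /and3P[? /eqP].
  have [zP fz] : z \in P :\ a /\ f z = i by move: zc; rewrite inE => /and3P[? /eqP].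
  by case/orP: (fc y z yP zP (etrans fy (esym fz))) => // /(ymax _ zc).
have {}hx : exists x : 'I_k -> T,
    forall i : 'I_k, x i \in cand i /\ {in cand i, forall y, le y (x i)}.
  apply: (@fin_all_exists 'I_k (fun=> T)
    (fun i y => y \in cand i /\ {in cand i, forall z, le z y})) => i.
  by have [x hxi] := hx i; exists x; apply: hxi.
case: hx => x hx.
have xP i : x i \in P :\ a by case: (hx i); rewrite inE => /andP[].
have fx i : f (x i) = i by case: (hx i); rewrite inE => /and3P[_ /eqP].
have xle (X : {set T}) (i : 'I_k) y : big X -> y \in X -> f y = i -> le y (x i).
  move=> bX yX fy; case: (hx i) => _; apply; rewrite inE fy eqxx.
  have /and3P[/subsetP/(_ _ yX) -> _ _] := bX.
  by apply/existsP; exists X; rewrite bX.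
have xinc i j : le (x i) (x j) -> i = j.
  move=> lij; case: (hx j); rewrite inE => /and3P[_ _ /existsP[X /andP[bX xjX]]] _.
  have [y yX fy] := big_color X i bX (ltn_ord i).
  have /and3P[_ /antichainP aX _] := bX.
  have : y = x j by apply: aX => //; apply: le_trans lij; apply: (xle X).
  by move=> yxj; apply/val_inj; rewrite /= -fy yxj fx.
(* Otherwise [a] and the [x i] would form an antichain of size [k + 1]. *)
have [i lia_] : exists i, le (x i) a.
  have [/existsP //|nle] := boolP [exists i, le (x i) a].
  have nle1 i : ~~ le (x i) a by move: nle; rewrite negb_exists => /forallP.
  have nle2 i : ~~ le a (x i).
    apply/negP => h; case/negP: (nle1 i); apply: amax => //.
    by have := xP i; rewrite inE => /andP[].
  have := hP (a |: [set x i | i : 'I_k]); rewrite cardsU1 card_imset; last first.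
    by move=> i j ij; apply: xinc; rewrite ij le_refl.
  rewrite card_ord.
  have -> : a \notin [set x i | i : 'I_k].
    by apply/imsetP=> -[i _ ai]; have := nle1 i; rewrite -ai le_refl.
  rewrite add1n ltnn => h; suff: false by []; apply: h.
    apply/subsetP=> y; rewrite !inE => /orP[/eqP->|/imsetP[i _ ->]] //.
    by have := xP i; rewrite inE => /andP[].
  apply/antichainP=> y z; rewrite !inE => /orP[/eqP->|/imsetP[i _ ->]].
    by move=> /orP[/eqP->|/imsetP[j _ ->]] //; rewrite (negbTE (nle2 j)).
  move=> /orP[/eqP->|/imsetP[j _ ->]]; first by rewrite (negbTE (nle1 i)).
  by move/xinc->.
pose K := a |: [set z in P :\ a | (f z == i) && le z (x i)].
have Kchain : {in K &, forall y z, le y z || le z y}.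
  have Ka z : z \in K -> le z a.
    rewrite !inE => /orP[/eqP->|/and3P[_ _ zx]]; first exact: le_refl.
    exact: le_trans lia_.
  move=> y z yK zK; have ya := Ka _ yK; have za := Ka _ zK.
  move: yK; rewrite inE => /orP[]; first by rewrite inE => /eqP->; rewrite za orbT.
  rewrite inE => /and3P[yP /eqP fy _].
  move: zK; rewrite inE => /orP[]; first by rewrite inE => /eqP->; rewrite ya.
  rewrite inE => /and3P[zP /eqP fz _].
  by apply: fc => //; rewrite fy fz.
have [|X XP aX|g [gk gc]] := IHn (P :\: K) k.-1.
- by apply: hQ; [apply: subsetDl | rewrite !inE eqxx].
- have XPa : X \subset P :\ a.
    apply: subset_trans XP _; apply/subsetP=> y; rewrite !inE.
    by case: (y == a) => //= /andP[].
  have Xk : #|X| <= k by apply: hP => //; apply: subset_trans PaP.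
  (* An antichain of size [k] outside [K] would contain an element of colour [i], which is below
     [x i] and hence in [K]. *)
  suff : #|X| != k by lia.
  apply/negP=> cX; have bX : big X by apply/and3P.
  have [y yX fy] := big_color X i bX (ltn_ord i).
  have /subsetP/(_ y yX) := XP; rewrite !inE fy eqxx (xle X) //= => /andP[].
  by rewrite negb_or andbT => /andP[-> /negP nP] yP; case: nP.
exists (fun x => if x \in K then k.-1 else g x); have ik := ltn_ord i.
split=> [y yP|y z yP zP].
  by case: ifP => yK; [lia|have := gk y; rewrite inE yK yP => /(_ isT); lia].
case: ifP => yK; case: ifP => zK.
- by move=> _; apply: Kchain.
- by have := gk z; rewrite inE zK zP => /(_ isT); lia.
- by have := gk y; rewrite inE yK yP => /(_ isT); lia.
by apply: gc; rewrite inE ?yK ?zK.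
Qed.
End Dilworth.

(** * Set families of bounded width at each point *)

Definition subset_rel (V : finType) : rel {set V} := fun S S' => S \subset S'.
Arguments subset_rel V : clear implicits.

Lemma subset_rel_refl (V : finType) : reflexive (subset_rel V).
Proof. exact: subxx. Qed.

Lemma subset_rel_trans (V : finType) : transitive (subset_rel V).
Proof. by move=> S2 S1 S3; exact: subset_trans. Qed.

(** If among any [k] members through a common point two are comparable, this holds with [w = k - 1];
    this is how semi-equations enter. *)
Definition pointwise_width_le (V : finType) (w : nat) (G : {set {set V}}) : Prop :=
  forall X : {set {set V}}, X \subset G -> antichain (subset_rel V) X ->
    forall v, (forall S, S \in X -> v \in S) -> #|X| <= w.

Lemma leq_card_bigcup (I T : finType) (P : pred I) (F : I -> {set T}) :
  #|\bigcup_(i | P i) F i| <= \sum_(i | P i) #|F i|.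
Proof.
elim/big_rec2: _ => [|i n X _ IH]; first by rewrite cards0.
by apply: leq_trans (leq_card_setU _ _) _; rewrite leq_add2l.
Qed.

(** Count the pairs of a point and a member of [X] containing it: each member has at least [n]
    points, all in [S], and each point of [S] lies in at most [w] members. *)
Lemma card_antichain_below (V : finType) (w n : nat) (G X : {set {set V}})
    (S : {set V}) :
    pointwise_width_le w G -> X \subset G -> antichain (subset_rel V) X ->
    (forall S', S' \in X -> S' \subset S /\ n <= #|S'|) -> 0 < n ->
    #|S| < 2 * n ->
  #|X| <= 2 * w.
Proof.
move=> hG XG aX hX n0 hS.
suff : #|X| * n <= #|S| * w by nia.
rewrite -!sum_nat_const.
apply: (@leq_trans (\sum_(S' in X) #|S'|)); first by apply: leq_sum => S' /hX[].
rewrite (eq_bigr (fun S' : {set V} => \sum_(v in S | v \in S') 1)); last first.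
  move=> S' /hX[/subsetP S'S _]; rewrite -sum1_card; apply: eq_bigl => v.
  by case: (boolP (v \in S')) => [/S'S ->|]; rewrite ?andbF.
rewrite (exchange_big_dep (mem S)) /=; last by move=> S' v _ /andP[].
apply: leq_sum => v vS; rewrite sum1dep_card.
apply: (hG _ _ _ v).
- by apply/subsetP=> S'; rewrite inE => /andP[/(subsetP XG)].
- by apply: antichainS aX; apply/subsetP=> S'; rewrite inE => /andP[].
by move=> S'; rewrite inE => /and3P[].
Qed.

(** The key of [S] is a minimal member of [G] inside [S], paired with the colour of [S] among the
    sets above that member. The members through [v] lie below at most [w] maximal ones, each
    containing at most [2 * w] minimal members of [G]; the factor [w.+1] counts colours. *)
Lemma level_coloring (V : finType) (w n : nat) (G : {set {set V}}) :
    pointwise_width_le w G -> (forall S, S \in G -> n <= #|S| < 2 * n) ->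
  exists (K : finType) (key : {set V} -> K),
    {in G &, forall S S', key S = key S' -> (S \subset S') || (S' \subset S)} /\
    forall v, #|key @: [set S in G | v \in S]| <= w * (2 * w) * w.+1.
Proof.
move=> hG hn.
have n0 S : S \in G -> 0 < n by move=> /hn; lia.
pose A := [set S in G | [forall S' in G, (S' \subset S) ==> (S' == S)]].
have AG : A \subset G by apply/subsetP=> S; rewrite inE => /andP[].
have aA : antichain (subset_rel V) A.
  apply/antichainP=> S S'; rewrite !inE => /andP[SG _] /andP[_ /forall_inP h] SS'.
  by apply/eqP; apply: (implyP (h _ SG)).
have [alpha halpha] : exists alpha : {set V} -> {set V},
    forall S, S \in G -> alpha S \in A /\ alpha S \subset S.
  apply: (@fin_all_exists {set V} (fun=> {set V})
    (fun S a => S \in G -> a \in A /\ a \subset S)) => S.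
  case: (boolP (S \in G)) => [SG|]; last by exists S.
  have [a /minsetP[aG amin] aS] := @minset_exists _ (mem G) S SG.
  have {}aG : a \in G by exact: aG.
  exists a => _; split=> //; rewrite inE aG; apply/forall_inP=> S' S'G.
  by apply/implyP=> /(amin _ S'G)->.
(* A point of the nonempty set [a] lies in every set above [a], so antichains among these have at
   most [w] members. *)
have [c hc] : exists c : {set V} -> {set V} -> nat, forall a, a \in A ->
    (forall S, S \in [set S in G | a \subset S] -> c a S < w) /\
    {in [set S in G | a \subset S] &, forall S S', c a S = c a S' ->
       (S \subset S') || (S' \subset S)}.
  apply: (@fin_all_exists {set V} (fun=> {set V} -> nat) (fun a c => a \in A ->
    (forall S, S \in [set S in G | a \subset S] -> c S < w) /\
    {in [set S in G | a \subset S] &, forall S S', c S = c S' ->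
       (S \subset S') || (S' \subset S)})) => a.
  case: (boolP (a \in A)) => [aA'|]; last by exists (fun=> 0).
  have [|c hc] := @dilworth _ _ (@subset_rel_refl V) (@subset_rel_trans V) w
    [set S in G | a \subset S]; last by exists c.
  have aG := subsetP AG _ aA'.
  have /card_gt0P[v va] : 0 < #|a| by have := hn a aG; have := n0 a aG; lia.
  move=> X /subsetP XP aX; apply: (hG _ _ aX v).
    by apply/subsetP=> S /XP; rewrite inE => /andP[].
  by move=> S /XP; rewrite inE => /andP[_ /subsetP]; apply.
(* The type ['I_w.+1] is used rather than ['I_w] because [inord] needs a nonempty ordinal. *)
exists ({set V} * 'I_w.+1)%type, (fun S => (alpha S, inord (c (alpha S) S))); split.
  move=> S S' SG S'G [ea]; have [aA1 aS] := halpha S SG.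
  have [aA2 aS'] := halpha S' S'G; have [cw cc] := hc _ aA1.
  have SU : S \in [set U in G | alpha S \subset U] by rewrite inE SG.
  have SU' : S' \in [set U in G | alpha S \subset U] by rewrite inE S'G ea.
  rewrite -ea.
  by move/(congr1 val); rewrite /= !inordK;
    [exact: cc|exact: leqW (cw _ _)|exact: leqW (cw _ _)].
move=> v; pose Gv := [set S in G | v \in S].
pose Mx := [set S in Gv | [forall S' in Gv, (S \subset S') ==> (S' == S)]].
have MG : Mx \subset G by apply/subsetP=> S; rewrite !inE => /andP[/andP[]].
have cM : #|Mx| <= w.
  apply: (hG _ MG _ v) => [|S]; last by rewrite !inE => /andP[/andP[]].
  apply/antichainP=> S S'; rewrite inE => /andP[_ /forall_inP h].
  by rewrite inE => /andP[S'G _] SS'; apply/esym/eqP; apply: (implyP (h _ S'G)).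
pose below (T : {set V}) := [set a in A | a \subset T].
have cU : #|\bigcup_(T in Mx) below T| <= w * (2 * w).
  apply: leq_trans (_ : \sum_(T in Mx) 2 * w <= _); last first.
    by rewrite sum_nat_const leq_mul2r cM orbT.
  apply: leq_trans (leq_card_bigcup _ _) _; apply: leq_sum => T /(subsetP MG) TG.
  have /andP[nT Tn] := hn T TG.
  apply: card_antichain_below (n0 T TG) Tn; first exact: hG.
  - by apply: subset_trans AG; apply/subsetP=> a; rewrite inE => /andP[].
  - by apply: antichainS aA; apply/subsetP=> a; rewrite inE => /andP[].
  by move=> a; rewrite inE => /andP[/(subsetP AG)/hn/andP[-> _] ->].
apply: leq_trans (_ : #|setX (\bigcup_(T in Mx) below T) [set: 'I_w.+1]| <= _); last first.
  by rewrite cardsX cardsT card_ord leq_mul2r cU orbT.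
apply/subset_leq_card/subsetP=> _ /imsetP[S SGv ->]; rewrite in_setX inE andbT.
have SG : S \in G by move: SGv; rewrite inE => /andP[].
have [aS aSS] := halpha S SG.
have [T /maxsetP[TGv Tmax] ST] := @maxset_exists _ (mem Gv) S SGv.
have {}TGv : T \in Gv by exact: TGv.
apply/bigcupP; exists T; last by rewrite inE aS (subset_trans aSS).
by rewrite inE TGv; apply/forall_inP=> S' S'G; apply/implyP=> /(Tmax _ S'G)->.
Qed.

(** * Tameness of relations of bounded width *)

Definition fiber (A B : finType) (e : A -> B -> bool) (b : B) : {set A} :=
  [set a | e a b].

(** Within a chain, a fiber contains [a] exactly when it is larger than all fibers of the chain that
    miss [a]. So [e a b] says that the key of [b] is one of the at most [r] keys met by [a] and that
    the fiber of [b] passes the size threshold of that key. *)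
Lemma tame_chains (A B K : finType) (e : A -> B -> bool) (key : B -> K) r m :
    #|A| < 2 ^ m -> #|B| < 2 ^ m ->
    (forall b b', key b = key b' ->
      (fiber e b \subset fiber e b') || (fiber e b' \subset fiber e b)) ->
    (forall a, #|key @: [set b | e a b]| <= r) ->
  tame (m.+2 ^ (3 * r.+1)) e.
Proof.
move=> hA hB hchain hr.
pose ks := undup [seq key b | b <- enum B].
pose k b := index (key b) ks.
have key_ks b : key b \in ks by rewrite mem_undup map_f ?mem_enum.
have kB b : k b < #|B|.
  apply: (@leq_trans (size ks)); first by rewrite index_mem.
  by apply: leq_trans (size_undup _) _; rewrite size_map -cardE.
have kI b b' : k b = k b' -> key b = key b'.
  by move=> kk; rewrite -[key b](nth_index (key b) (key_ks b)) -/(k b) kk nth_index.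
pose codes a := [seq index x ks | x <- enum (key @: [set b | e a b])].
(* [keyi i a] is the code of the [i]-th chain met by [a]; the default [#|B|] is no code and stays
   below [2 ^ m]. [thr i a] is the largest size of a fiber of that chain missing [a]. *)
pose keyi i a := nth #|B| (codes a) i.
pose thr i a := \max_(b | (k b == keyi i a) && ~~ e a b) #|fiber e b|.
have codeP a x : x \in codes a -> exists2 b, e a b & x = k b.
  case/mapP=> y; rewrite mem_enum => /imsetP[b]; rewrite inE => eab -> ->.
  by exists b.
rewrite expnM; apply: tame_ext (@tame_has _ _ (m.+2 ^ 3) r
    (fun i a b => (keyi i a == k b) && (thr i a < #|fiber e b|)) _ _); first last.
- move=> i; have NN : 1 < m.+2 * m.+2 by [].
  rewrite 2!expnS expn1 mulnA; apply: tame_and => //.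
    apply: tame_eqn => [a|b]; last exact: ltn_trans hB.
    apply: leq_ltn_trans hB; rewrite /keyi.
    case: (ltnP i (size (codes a))) => hi; last by rewrite nth_default.
    by have [b _ ->] := codeP a _ (mem_nth #|B| hi); apply: ltnW.
  apply: tame_le (leqnSn _) (tame_ltn _ _) => [a|b].
    by apply: leq_ltn_trans hA; apply/bigmax_leqP => b _; apply: max_card.
  exact: leq_ltn_trans (max_card _) hA.
- by rewrite -{1}(exp1n 3) ltn_exp2r.
move=> a b; apply/hasP/idP => [[i _ /andP[/eqP ki thri]]|eab].
  apply/negPn/negP => neab; move: thri; rewrite ltnNge => /negP; apply.
  by apply: leq_bigmax_cond; rewrite ki eqxx.
have kb : k b \in codes a.
  by apply: map_f; rewrite mem_enum; apply: imset_f; rewrite inE.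
have ib : index (k b) (codes a) < size (codes a) by rewrite index_mem.
have keyib : keyi (index (k b) (codes a)) a = k b by rewrite /keyi nth_index.
exists (index (k b) (codes a)).
  rewrite mem_iota /= add0n; apply: leq_trans ib _.
  by rewrite size_map -cardE; apply: hr.
rewrite keyib eqxx /= /thr keyib.
have a_b : a \in fiber e b by rewrite inE.
have b0 : 0 < #|fiber e b| by apply/card_gt0P; exists a.
rewrite -(prednK b0) ltnS; apply/bigmax_leqP=> b' /andP[/eqP kb' neab'].
rewrite -ltnS (prednK b0).
have a_b' : a \notin fiber e b' by rewrite inE.
case/orP: (hchain _ _ (kI _ _ kb')) => [h|/subsetP/(_ _ a_b)]; last by rewrite (negbTE a_b').
by apply: proper_card; apply/properP; split=> //; exists a.
Qed.

Lemma tame_width (A B : finType) (e : A -> B -> bool) w m :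
    #|A| < 2 ^ m -> #|B| < 2 ^ m ->
    pointwise_width_le w [set fiber e b | b : B] ->
  tame (m.+2 * m.+2 ^ (3 * (w * (2 * w) * w.+1).+1)) e.
Proof.
move=> hA hB hw; set r := w * _ * _.
pose lev b := trunc_log 2 #|fiber e b|.
pose ej (j : nat) a b := e a b && (lev b == j).
apply: tame_ext (tame_case (J := m.+2) (lev := lev) (e := ej) _ _).
- by move=> a b; rewrite /ej eqxx andbT.
- move=> b; have [b0|b0] := posnP #|fiber e b|; first by rewrite /lev b0 trunc_log0.
  apply: (@leq_ltn_trans m) => //; rewrite -(leq_exp2l _ _ (ltnSn 1)).
  apply: leq_trans (_ : #|fiber e b| <= _).
    by case/andP: (trunc_log_bounds (ltnSn 1) b0).
  exact: ltnW (leq_ltn_trans (max_card _) hA).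
move=> j.
have fj b : fiber (ej j) b = if lev b == j then fiber e b else set0.
  by apply/setP=> a; rewrite /ej inE; case: eqP; rewrite ?andbT ?andbF inE.
(* The empty set is removed so that all sizes lie between [2 ^ j] and [2 ^ j.+1]; empty fibers get
   the key [None] below. *)
pose G := [set fiber (ej j) b | b : B] :\ set0.
have GP (S : {set A}) : S \in G -> exists b, [/\ S = fiber e b, lev b = j & 0 < #|S|].
  rewrite !inE => /andP[S0 /imsetP[b _ Sb]]; exists b; move: Sb; rewrite fj.
  case: eqP => [lb|_ S0']; last by rewrite S0' eqxx in S0.
  by move=> Se; split=> //; rewrite card_gt0.
have [||K [key [kc kr]]] := @level_coloring A w (2 ^ j) G.
- move=> X /subsetP XG; apply: hw; apply/subsetP=> S /XG/GP[b [-> _ _]].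
  exact: imset_f.
- move=> S /GP[b [Sb lb S0]]; rewrite -expnS -lb /lev -Sb.
  exact: trunc_log_bounds.
pose key' b := if fiber (ej j) b == set0 then None else Some (key (fiber (ej j) b)).
have inG b : fiber (ej j) b != set0 -> fiber (ej j) b \in G.
  by move=> h; rewrite !inE h imset_f.
apply: (@tame_chains _ _ _ _ key') => // [b b'|a].
  rewrite /key'; case: eqP => [->|/eqP/inG hb]; first by rewrite sub0set.
  case: eqP => [->|/eqP/inG hb']; first by rewrite sub0set orbT.
  by case=> /kc; apply.
apply: leq_trans (kr a); rewrite -[leqRHS](card_imset _ (@Some_inj _)).
apply/subset_leq_card/subsetP=> x /imsetP[b]; rewrite inE => eab ->.
have ab : a \in fiber (ej j) b by rewrite inE.
have nb : fiber (ej j) b != set0 by apply/set0Pn; exists a.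
by rewrite /key' (negbTE nb); apply/imset_f/imset_f; rewrite inE ab inG.
Qed.

From mathcomp Require Import all_classical all_reals exp.
From mathcomp Require Import ring lra.
Import Order.TTheory GRing.Theory Num.Theory.

(** * Formulas in 1-semi-equational theories *)

Definition trace (L : language) (M : structure L) (p q : nat)
    (phi : pformula L p q) (A B : Type) (alpha : A -> 'I_p -> M)
    (beta : B -> 'I_q -> M) (a : A) (b : B) : bool :=
  `[< psat phi (alpha a) (beta b) >].

(** The bound is polylogarithmic in the sizes and uniform over the models. The exponent [c.+1] keeps
    it at least 2, as [tame_and] requires. *)
Definition polylog_tame (L : language) (T : theory L) (p q : nat)
    (phi : pformula L p q) : Prop :=
  exists c : nat, forall M : structure L, models M T ->
    forall (A B : finType) (alpha : A -> 'I_p -> M) (beta : B -> 'I_q -> M) m,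
      #|A| < 2 ^ m -> #|B| < 2 ^ m ->
      tame (m.+2 ^ c.+1) (trace phi alpha beta).

Section PolylogTame.
Variables (L : language) (T : theory L) (p q : nat).
Implicit Types phi psi : pformula L p q.

Lemma polylog_tame_semi_equation k phi : semi_equation T k phi -> polylog_tame T phi.
Proof.
move=> hphi; exists (3 * (k.-1 * (2 * k.-1) * k.-1.+1).+1).
move=> M MT A B alpha beta m hA hB; rewrite expnS.
have [k2 hk] := hphi M MT.
apply: tame_width => // X /fintype.subsetP XB /antichainP aX v vX.
rewrite leqNgt; apply/negP => kX.
(* The semi-equation, applied to the parameters of [k] members of [X], makes two of them comparable,
   as all contain [v]. *)
have {}kX : k <= #|X| by lia.
pose g (i : 'I_k) : {set A} := enum_val (widen_ord kX i).
have gX i : g i \in X by apply: enum_valP.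
have [b hb] : exists b : 'I_k -> B, forall i, g i = fiber (trace phi alpha beta) (b i).
  apply: (@fin_all_exists 'I_k (fun=> B)
    (fun i b => g i = fiber (trace phi alpha beta) b)) => i.
  by have /imsetP[b _ ->] := XB _ (gX i); exists b.
have [|i [j [ij hij]]] := hk (fun i => beta (b i)).
  by exists (alpha v) => j; have := vX _ (gX j); rewrite hb inE => /asboolP.
apply: ij; apply/val_inj; apply: (congr1 val (_ : widen_ord kX i = widen_ord kX j)).
apply: enum_val_inj.
apply: aX; [exact: gX|exact: gX|].
rewrite -/(g i) -/(g j) !hb; apply/fintype.subsetP=> a; rewrite !inE.
exact: hij.
Qed.

Lemma polylog_tame_bot : polylog_tame T (Bot L _ : pformula L p q).
Proof.
exists 0 => M MT A B alpha beta m _ _.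
apply: tame_le (tame_ext _ (tame_left B (fun=> false))) => // a b.
by apply/esym/negbTE/negP => /asboolP.
Qed.

Lemma polylog_tame_not phi : polylog_tame T phi -> polylog_tame T (Not phi).
Proof.
move=> [c h]; exists c => M MT A B alpha beta m hA hB.
apply: tame_ext (tame_not (h M MT A B alpha beta m hA hB)) => a b.
by rewrite -asbool_neg.
Qed.

Lemma polylog_tame_and phi psi :
  polylog_tame T phi -> polylog_tame T psi -> polylog_tame T (And phi psi).
Proof.
move=> [c h] [d g]; exists (c + d.+1) => M MT A B alpha beta m hA hB.
have e1 n : 1 < m.+2 ^ n.+1 by rewrite -{1}(exp1n n.+1) ltn_exp2r.
rewrite -addSn expnD; apply: tame_ext (tame_and (e1 c) (e1 d)
  (h M MT A B alpha beta m hA hB) (g M MT A B alpha beta m hA hB)) => a b.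
by rewrite -asbool_and.
Qed.

Lemma polylog_tame_equiv phi psi :
  equivalent_mod T phi psi -> polylog_tame T psi -> polylog_tame T phi.
Proof.
move=> eqv [c h]; exists c => M MT A B alpha beta m hA hB.
apply: tame_ext (h M MT A B alpha beta m hA hB) => a b.
by apply: asbool_equiv_eq; apply: iff_sym; apply: eqv.
Qed.

Lemma polylog_tame_bool_comb k phi :
  bool_comb [set theta | semi_equation T k theta]%classic phi -> polylog_tame T phi.
Proof.
elim=> {phi} [phi /polylog_tame_semi_equation //| |phi _|phi psi _ h1 _ h2
  |phi psi _ h1 _ h2|phi psi _ h1 _ h2].
- exact: polylog_tame_bot.
- exact: polylog_tame_not.
- exact: polylog_tame_and.
- apply: polylog_tame_equiv (polylog_tame_not
    (polylog_tame_and (polylog_tame_not h1) (polylog_tame_not h2))) => M MT v /=.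
  by rewrite not_andE !notK.
- apply: polylog_tame_equiv (polylog_tame_not
    (polylog_tame_and h1 (polylog_tame_not h2))) => M MT v /=.
  by rewrite not_andE notK implyE orC.
Qed.

End PolylogTame.

(** Both conclusions of the theorem rest on this form. The vertices are indexed by maps that need
    not be injective, since a trace may identify vertices. *)
Lemma zarankiewicz_trace (L : language) (T : theory L) (p q : nat)
    (phi : pformula L p q) : one_semi_equational T ->
  exists c : nat, forall M : structure L, models M T ->
    forall (A B : finType) (alpha : A -> 'I_p -> M) (beta : B -> 'I_q -> M) m t,
      #|A| + #|B| < 2 ^ m ->
      (forall (X : {set A}) (Y : {set B}), #|X| = t -> #|Y| = t ->
        ~ (forall a b, a \in X -> b \in Y -> trace phi alpha beta a b)) ->
      #|[set x : A * B | trace phi alpha beta x.1 x.2]%SET|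
        <= m.+2 ^ c * t * (#|A| + #|B|).
Proof.
move=> hT; have [k [psi [_ hpsi eqv]]] := hT p q phi.
have [c h] := polylog_tame_equiv eqv (polylog_tame_bool_comb hpsi).
exists c.+1 => M MT A B alpha beta m t hn hK.
have hA : #|A| < 2 ^ m by apply: leq_ltn_trans hn; apply: leq_addr.
have hB : #|B| < 2 ^ m by apply: leq_ltn_trans hn; apply: leq_addl.
by apply: zarankiewicz_bicover hK; case: (h M MT A B alpha beta m hA hB).
Qed.

(** * The almost linear bound with real logarithms *)

Lemma card_range_ord (T : Type) (n : nat) (g : 'I_n -> T) :
  injective g -> (range g #= `I_n)%card.
Proof.
move=> gI; apply: (@card_eq_trans _ _ _ _ [set: 'I_n]%classic).
  by apply: inj_card_eq => x y _ _; apply: gI.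
suff <- : range (val : 'I_n -> nat) = (`I_n)%classic.
  by apply/card_esym/inj_card_eq => x y _ _; apply: val_inj.
apply/seteqP; split=> [_ [i _ <-]|k kn] /=; first exact: ltn_ord.
by exists (Ordinal kn).
Qed.

Lemma card_ord_range (T : Type) (n : nat) (V : set T) : (V #= `I_n)%card ->
  exists2 g : 'I_n -> T, injective g & V = range g.
Proof.
move=> /card_esym/card_bijP[f fbij].
have memI (i : 'I_n) : (i : nat) \in (`I_n)%classic by apply/mem_set; apply: ltn_ord.
exists (fun i => val (f (SigSub (memI i)))).
  move=> i j /val_inj/(bij_inj fbij)/(congr1 val) /= ij; exact: val_inj.
have [h fh hf] := fbij.
apply/seteqP; split=> [x Vx|_ [i _ <-]]; last by apply: set_mem; apply: valP.
have xV : x \in V by apply/mem_set.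
pose k := h (SigSub xV); have kn : val k < n by apply: set_mem (valP k).
exists (Ordinal kn) => //; rewrite (_ : SigSub _ = k) ?hf //.
exact: val_inj.
Qed.

Lemma almost_linear_zarankiewicz_one_semi_equational (R : realType)
    (L : language) (T : theory L) :
  one_semi_equational T -> almost_linear_zarankiewicz R T.
Proof.
move=> hT p q phi t _; have [c hc] := zarankiewicz_trace phi hT.
(* Below, [m.+2] is [trunc_log 2 (v + w) + 3], at most [3 + ln (1 + n) / ln 2], hence at most
   [K * (1 + ln (1 + n))]. *)
pose K : R := (3 + (ln 2)^-1)%R.
have ln2 : (0 < ln (2 : R))%R by rewrite ln_gt0 // ltr1n.
have K0 : (0 <= K)%R by rewrite addr_ge0 // invr_ge0 ltW.
exists (t%:R * K ^+ c)%R, c%:R%R; split; rewrite ?mulr_ge0 ?exprn_ge0 ?ler0n //.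
move=> M MT V W v w e hV hW hE hK; cbv zeta; set n : R := (v + w)%:R%R.
have [alpha alphaI Va] := card_ord_range hV.
have [beta betaI Wb] := card_ord_range hW.
pose X := [set x : 'I_v * 'I_w | trace phi alpha beta x.1 x.2]%SET.
have eX : e = #|X|.
  apply/esym/card_eq_II; apply: card_eq_trans hE; apply/card_esym.
  pose g (i : 'I_#|X|) := (alpha (enum_val i).1, beta (enum_val i).2).
  have gI : injective g.
    move=> i j [/alphaI h1 /betaI h2]; apply: enum_val_inj.
    by case: (enum_val i) (enum_val j) h1 h2 => [? ?] [? ?] /= -> ->.
  rewrite (_ : bip_edges _ _ _ = range g); first exact: card_range_ord.
  apply/seteqP; split=> [[a b] /= [/=]|_ [i _ <-]].
    rewrite Va Wb => -[i _ <-] [j _ <-] ij.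
    have ijX : (i, j) \in X by rewrite inE; apply/asboolP.
    by exists (enum_rank_in ijX (i, j)) => //; rewrite /g enum_rankK_in.
  rewrite Va Wb; split; [by exists (enum_val i).1|by exists (enum_val i).2|].
  by have := enum_valP i; rewrite inE => /asboolP.
pose m := (trunc_log 2 (v + w)).+1.
have hm : v + w < 2 ^ m by apply: trunc_log_ltn.
have := hc M MT _ _ alpha beta m t; rewrite !card_ord => /(_ hm).
have hK' (Y : {set 'I_v}) (Z : {set 'I_w}) : #|Y| = t -> #|Z| = t ->
    ~ (forall a b, a \in Y -> b \in Z -> trace phi alpha beta a b).
  move=> Yt Zt YZ; apply: hK.
  exists (range (fun i : 'I_#|Y| => alpha (enum_val i))),
    (range (fun i : 'I_#|Z| => beta (enum_val i))); split.
  - by move=> _ [i _ <-]; rewrite Va; exists (enum_val i).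
  - by move=> _ [i _ <-]; rewrite Wb; exists (enum_val i).
  - by rewrite -Yt; apply: card_range_ord => i j /alphaI/enum_val_inj.
  - by rewrite -Zt; apply: card_range_ord => i j /betaI/enum_val_inj.
  move=> [_ _] /= [[i _ <-] [j _ <-]]; rewrite Va Wb; split=> /=.
  - by exists (enum_val i).
  - by exists (enum_val j).
  by apply/asboolP/YZ; apply: enum_valP.
move=> /(_ hK'); rewrite -/X -eX => he.
have n0 : (0 <= n)%R by apply: ler0n.
have l0 : (0 <= ln (1 + n))%R by rewrite ln_ge0 // lerDl.
rewrite powR_mulrn ?addr_ge0 //.
have mK : (m.+2%:R <= K * (1 + ln (1 + n)))%R.
  have tl : ((trunc_log 2 (v + w))%:R * ln (2 : R) <= ln (1 + n))%R.
    rewrite mulr_natl -lnXn // ler_ln ?posrE ?exprn_gt0 ?ltr_wpDr //.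
    rewrite -natrX /n -[1%R]/(1%:R)%R -natrD ler_nat add1n.
    have [->//|n1] := posnP (v + w); apply: leqW.
    by case/andP: (trunc_log_bounds (ltnSn 1) n1).
  rewrite /m -!natr1 /K; move: tl; rewrite -ler_pdivlMr //.
  have : (0 <= (ln (2 : R))^-1)%R by rewrite invr_ge0 ltW.
  by set l2 := (ln 2)^-1%R; nra.
apply: (@le_trans _ _ (m.+2 ^ c * t * (v + w))%:R%R); first by rewrite ler_nat.
have hc' : (m.+2%:R ^+ c <= K ^+ c * (1 + ln (1 + n)) ^+ c)%R.
  rewrite -exprMn; apply: lerXn2r => //; rewrite nnegrE ?ler0n //.
  by apply: le_trans mK; rewrite ler0n.
rewrite !natrM natrX -/n -mulrA.
apply: le_trans (ler_wpM2r _ hc') _; first by rewrite mulr_ge0 ?ler0n.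
by rewrite le_eqVlt; apply/orP; left; apply/eqP; ring.
Qed.

(** * Infinite domains *)

Section BoundedSums.
Variable D : idomainType.
Implicit Types (xs ys zs : seq D) (a b x y : D) (s : nat).
Local Open Scope ring_scope.

(** A generalized arithmetic progression with generators [zs], listed with multiplicity; for [s = 1]
    these are the subset sums. *)
Fixpoint bounded_sums s zs : seq D :=
  if zs is z :: zs' then
    [seq z *+ c + b | c <- iota 0 s.+1, b <- bounded_sums s zs']
  else [:: 0].

Lemma size_bounded_sums s zs : size (bounded_sums s zs) = (s.+1 ^ size zs)%N.
Proof.
elim: zs => // z zs IHzs.
rewrite expnS -IHzs -[in RHS](size_iota 0 s.+1).
exact: (size_allpairs (fun c b => z *+ c + b)).
Qed.

Lemma mem_bounded_sums_cons s z zs b :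
  reflect (exists c b', [/\ (c <= s)%N, b' \in bounded_sums s zs & b = z *+ c + b'])
    (b \in bounded_sums s (z :: zs)).
Proof.
apply: (iffP allpairsP) => [[[c b'] [cs b's ->]]|[c [b' [cs b's ->]]]].
  by exists c, b'; split=> //; move: cs; rewrite mem_iota.
by exists (c, b'); split; rewrite ?mem_iota.
Qed.

Lemma bounded_sums0 s zs : 0 \in bounded_sums s zs.
Proof.
elim: zs => [|z zs IHzs]; first by rewrite inE.
by apply/mem_bounded_sums_cons; exists 0%N, 0; rewrite mulr0n addr0.
Qed.

Lemma bounded_sumsD s s' zs a b : a \in bounded_sums s zs ->
  b \in bounded_sums s' zs -> a + b \in bounded_sums (s + s') zs.
Proof.
elim: zs a b => [|z zs IHzs] a b; first by rewrite !inE => /eqP-> /eqP->; rewrite addr0.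
move=> /mem_bounded_sums_cons[c [a' [cs ha ->]]].
move=> /mem_bounded_sums_cons[c' [b' [cs' hb ->]]].
apply/mem_bounded_sums_cons; exists (c + c')%N, (a' + b').
by rewrite leq_add // IHzs // mulrnDr addrACA.
Qed.

Lemma bounded_sums_cat s ys zs a b : a \in bounded_sums s ys ->
  b \in bounded_sums s zs -> a + b \in bounded_sums s (ys ++ zs).
Proof.
elim: ys a => [|y ys IHys] a /= ; first by rewrite inE => /eqP-> ?; rewrite add0r.
move=> /mem_bounded_sums_cons[c [a' [cs ha ->]]] hb.
by apply/mem_bounded_sums_cons; exists c, (a' + b); rewrite IHys // addrA.
Qed.

Lemma bounded_sumsZ s zs x b : b \in bounded_sums s zs ->
  x * b \in bounded_sums s [seq x * z | z <- zs].
Proof.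
elim: zs b => [|z zs IHzs] b; first by rewrite !inE => /eqP->; rewrite mulr0.
move=> /mem_bounded_sums_cons[c [b' [cs hb ->]]].
by apply/mem_bounded_sums_cons; exists c, (x * b'); rewrite IHzs // mulrDr mulrnAr.
Qed.

(** Coefficients 0 and 1 are closed under multiplication. Hence adding a product of two subset sums
    of [xs] to a sum of products raises the coefficient bound by only 1. *)
Lemma bounded_sumsM xs ys a b : a \in bounded_sums 1 xs ->
  b \in bounded_sums 1 ys -> a * b \in bounded_sums 1 [seq x * y | x <- xs, y <- ys].
Proof.
elim: xs a => [|x xs IHxs] a; first by rewrite !inE => /eqP->; rewrite mul0r.
move=> /mem_bounded_sums_cons[c [a' [c1 ha ->]]] hb.
rewrite allpairs_cons mulrDl; apply: bounded_sums_cat; last exact: IHxs.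
rewrite mulrnAl; case: c c1 => [|[|//]] _; last exact: bounded_sumsZ.
exact: bounded_sums0.
Qed.

Hypothesis infD : infinite_set [set: D].

Lemma infinite_notin (zs : seq D) : exists x, x \notin zs.
Proof.
apply: contrapT => h; apply: infD; apply: sub_finite_set (finite_seq zs) => x _ /=.
by apply: contrapT => /negP xs; apply: h; exists x.
Qed.

(** The new generator avoids all differences of earlier sums, so adding it to a sum never gives an
    earlier one. *)
Lemma exists_distinct_sums d :
  exists2 xs : seq D, size xs = d & uniq (bounded_sums 1 xs).
Proof.
elim: d => [|d [xs sxs uxs]]; first by exists [::].
have [x hx] := infinite_notin [seq b - a | b <- bounded_sums 1 xs, a <- bounded_sums 1 xs].
exists (x :: xs); first by rewrite /= sxs.
rewrite /= cats0 cat_uniq mulr0n mulr1n !map_inj_uniq ?uxs /= ?andbT; try exact: addrI.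
apply/hasPn=> _ /mapP[a ha ->]; apply/mapP=> -[b hb]; rewrite add0r => xab.
case/negP: hx; apply/allpairsP; exists (b, a); split=> //=.
by rewrite -xab addrK.
Qed.

(* Pigeonhole: the sets of sums with coefficients at most [s] cannot double at
   each of the first [2 ^ d - 1] steps, as their sizes are at most
   [(s + 1) ^ (d * d)]. *)
Lemma exists_small_doubling d : (d ^ 3 < 2 ^ d - 1)%N ->
  exists X B B' : seq D,
    [/\ [/\ uniq X, uniq B & uniq B'], size X = (2 ^ d)%N,
        {in X &, forall a x, {in B, forall b, a * x + b \in B'}} &
        [/\ (0 < size B)%N, (size B <= 2 ^ d ^ 3)%N & (size B' <= 2 * size B)%N]].
Proof.
move=> hd; have [xs sxs uX] := exists_distinct_sums d.
pose zs := [seq x * y | x <- xs, y <- xs].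
(* The products in [zs] need not be generic, so their sums may coincide. *)
pose B s := undup (bounded_sums s zs).
have Bs s : (size (B s) <= s.+1 ^ (d * d))%N.
  by apply: leq_trans (size_undup _) _; rewrite size_bounded_sums size_allpairs sxs.
have B0 s : (0 < size (B s))%N.
  have : 0 \in B s by rewrite mem_undup bounded_sums0.
  by case: (B s).
have dd : (d * d * d = d ^ 3)%N by rewrite !expnS expn0 muln1 mulnA.
have Bd s : (s < 2 ^ d)%N -> (size (B s) <= 2 ^ d ^ 3)%N.
  move=> hs; apply: leq_trans (Bs s) _.
  by rewrite -dd [(d * d * d)%N]mulnC (expnM 2) leq_exp2r // muln_gt0; case: (d) hd.
have [s hs hB] : exists2 s, (s.+1 < 2 ^ d)%N & (size (B s.+1) <= 2 * size (B s))%N.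
  apply: contrapT => h.
  have grow s : (s < 2 ^ d)%N -> (2 ^ s <= size (B s))%N.
    elim: s => [|s IHs] hs; first by rewrite expn0 B0.
    rewrite expnS; apply: (@leq_trans (2 * size (B s))).
      by rewrite leq_mul2l IHs // ltnW.
    by rewrite leqNgt; apply/negP => /ltnW hlt; apply: h; exists s.
  have d1 : (2 ^ d - 1 < 2 ^ d)%N by have := expn_gt0 2 d; lia.
  by have := leq_trans (grow _ d1) (Bd _ d1); rewrite leq_exp2l // leqNgt hd.
exists (bounded_sums 1 xs), (B s), (B s.+1); split=> //.
- by rewrite !undup_uniq.
- by rewrite size_bounded_sums sxs.
- move=> a x ha hx b; rewrite !mem_undup -add1n => hb.
  by apply: bounded_sumsD hb; apply: bounded_sumsM.
by split=> //; apply: Bd; apply: ltnW.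
Qed.

End BoundedSums.

(** The first inequality feeds the pigeonhole argument; the second lets the [2 ^ d] slopes beat the
    polylogarithmic factor. With [d = 2 ^ u], both reduce to [2 ^ u] exceeding a linear function of
    [u]. *)
Lemma exists_exponent c : exists d : nat,
  (d ^ 3 < 2 ^ d - 1)%N /\ (6 * (d ^ 3 + d + 4) ^ c < 2 ^ d)%N.
Proof.
have lin a b : exists u, (0 < u)%N /\ (a * u + b < 2 ^ u)%N.
  have sq y : (y.+1 * y.+1 <= 2 ^ (2 * y))%N.
    by rewrite [(2 * y)%N]mulnC (expnM 2) -[leqRHS]mulnn leq_mul // ltn_expl.
  exists (2 * (2 * a + b).+1)%N; split=> //; apply: leq_trans (sq _); nia.
have [u [u0 hu]] := lin (3 * c.+1)%N (3 * c.+1 + 3)%N.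
have u2 : (2 <= 2 ^ u)%N by rewrite -{1}(expn1 2) leq_exp2l.
exists (2 ^ u)%N; have -> : ((2 ^ u) ^ 3 = 2 ^ (3 * u))%N by rewrite mulnC expnM.
split.
  have : (2 ^ (3 * u).+1 <= 2 ^ 2 ^ u)%N by rewrite leq_exp2l //; nia.
  have : (2 ^ 1 <= 2 ^ (3 * u))%N by rewrite leq_exp2l //; lia.
  by rewrite expn1 (expnS 2 (3 * u)); lia.
have h8 : (2 ^ (3 * u) + 2 ^ u + 4 <= 2 ^ (3 * u + 3))%N.
  rewrite expnD; have : (2 ^ u <= 2 ^ (3 * u))%N by rewrite leq_exp2l //; lia.
  by have -> : (2 ^ 3 = 8)%N by []; lia.
apply: (@leq_ltn_trans (2 ^ 3 * 2 ^ ((3 * u + 3) * c))%N).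
  by apply: leq_mul => //; rewrite (expnM 2 (3 * u + 3)); case: (c) => // n; rewrite leq_exp2r.
by rewrite -expnD ltn_exp2l //; nia.
Qed.

(** * Renaming of variables *)

Fixpoint rename_term (L : language) (X Y : Type) (rho : X -> Y) (t : term L X) :
    term L Y :=
  match t with
  | Var x => Var L (rho x)
  | App f ts => App (f := f) (fun i => rename_term rho (ts i))
  end.

Fixpoint rename (L : language) (X Y : Type) (rho : X -> Y) (phi : formula L X)
    {struct phi} : formula L Y :=
  match phi with
  | Bot => Bot L Y
  | Eq t u => Eq (rename_term rho t) (rename_term rho u)
  | Rel r ts => Rel (r := r) (fun i => rename_term rho (ts i))
  | Not f => Not (rename rho f)
  | And f g => And (rename rho f) (rename rho g)
  | Or f g => Or (rename rho f) (rename rho g)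
  | Imp f g => Imp (rename rho f) (rename rho g)
  | All f => All (rename (option_map rho) f)
  | Ex f => Ex (rename (option_map rho) f)
  end.

Lemma eval_rename (L : language) (M : structure L) (X Y : Type) (rho : X -> Y)
    (v : Y -> M) (t : term L X) : eval v (rename_term rho t) = eval (v \o rho) t.
Proof. by elim: t => //= f ts IH; congr finterp; apply/funext => i. Qed.

Lemma sat_rename (L : language) (M : structure L) (X : Type) (phi : formula L X) :
  forall (Y : Type) (rho : X -> Y) (v : Y -> M),
    sat v (rename rho phi) <-> sat (v \o rho) phi.
Proof.
have ext (X' Y : Type) (rho : X' -> Y) (v : Y -> M) (a : M) :
    extend v a \o option_map rho = extend (v \o rho) a.
  by apply/funext => -[x|].
elim: {X} phi => [X|X t u|X r ts|X f IHf|X f IHf g IHg|X f IHf g IHg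
    |X f IHf g IHg|X f IHf|X f IHf] Y rho v //=; rewrite ?IHf ?IHg //.
- by rewrite !eval_rename.
- by rewrite (_ : (fun i => _) = (fun i => eval (v \o rho) (ts i))) //;
    apply/funext => i; rewrite eval_rename.
- by split=> h a; move: (h a); rewrite IHf ext.
- by split=> -[a ha]; exists a; move: ha; rewrite IHf ext.
Qed.

(** * Incidences of points and lines *)

Section Incidences.
Variable D : idomainType.
Local Open Scope ring_scope.

Definition incident (P l : D * D) : bool := P.2 == l.1 * P.1 + l.2.

(** Subtracting the equations leaves [(a - a') * (x - x') = 0]; the absence of zero divisors makes
    the slopes or the abscissas equal. *)
Lemma incident_two_points (P Q l l' : D * D) :
  incident P l -> incident P l' -> incident Q l -> incident Q l' ->
  P = Q \/ l = l'.
Proof.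
case: P Q l l' => [x y] [x' y'] [a b] [a' b'].
rewrite /incident /= => /eqP-> /eqP e1 /eqP-> /eqP e2.
have : (a - a') * (x - x') == 0.
  by apply/eqP; transitivity ((a * x + b - (a' * x + b')) -
     (a * x' + b - (a' * x' + b'))); [ring|rewrite e1 e2 !subrr].
rewrite mulf_eq0 !subr_eq0 => /orP[]/eqP e; rewrite -e in e1 *; last by left.
by right; rewrite (addrI _ e1).
Qed.

Definition point_line (X B B' : seq D)
    (P : seq_sub X * seq_sub B') (l : seq_sub X * seq_sub B) : bool :=
  incident (val P.1, val P.2) (val l.1, val l.2).

Lemma point_line_K22_free (X B B' : seq D)
    (Y : {set seq_sub X * seq_sub B'}) (Z : {set seq_sub X * seq_sub B}) :
  #|Y| = 2%N -> #|Z| = 2%N ->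
  ~ (forall P l, P \in Y -> l \in Z -> point_line P l).
Proof.
move=> /eqP/cards2P[P [Q [PQ ->]]] /eqP/cards2P[l [l' [ll' ->]]] h.
case: (incident_two_points (h P l _ _) (h P l' _ _) (h Q l _ _) (h Q l' _ _));
  rewrite ?inE ?eqxx ?orbT // => -[/val_inj e1 /val_inj e2].
  by move: PQ; rewrite [P]surjective_pairing [Q]surjective_pairing e1 e2 eqxx.
by move: ll'; rewrite [l]surjective_pairing [l']surjective_pairing e1 e2 eqxx.
Qed.

(** Each triple [(a, x, b)] yields the incidence of the point [(x, a * x + b)] with the line
    [(a, b)], and is recovered from it. *)
Lemma leq_card_point_line (X B B' : seq D) : uniq X -> uniq B ->
    {in X &, forall a x, {in B, forall b, a * x + b \in B'}} ->
  (size X * size X * size B <=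
    #|[set e : (seq_sub X * seq_sub B') * (seq_sub X * seq_sub B)
        | point_line e.1 e.2]%SET|)%N.
Proof.
move=> uX uB hB.
pose g (t : seq_sub X * seq_sub X * seq_sub B) :=
  ((t.1.2, SeqSub (hB _ _ (valP t.1.1) (valP t.1.2) _ (valP t.2)) : seq_sub B'),
   (t.1.1, t.2)).
have gI : injective g by move=> [[a x] b] [[a' x'] b'] [-> _ -> ->].
rewrite -(card_seq_sub uB) -(card_seq_sub uX) -!card_prod.
rewrite -cardsT -(card_imset _ gI); apply/subset_leq_card/fintype.subsetP => _ /imsetP[t _ ->].
by rewrite inE /point_line /incident.
Qed.

End Incidences.

Lemma no_locally_trace_defines (L : language) (T : theory L) (D : idomainType) :
    one_semi_equational T -> infinite_set [set: D]%classic ->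
  ~ locally_trace_defines T (ring_structure D).
Proof.
move=> hT infD [M [MT hM]].
pose R := [set a : 'I_4 -> D |
  a (inord 1) = a (inord 2) * a (inord 0) + a (inord 3)]%R%classic.
have defR : definable (R : set ('I_4 -> ring_structure D)).
  pose var i := Var ring_language (inl (inord i) : 'I_4 + 'I_0)%type.
  exists 0%N, (Eq (var 1%N) (App (f := Radd : Defs.fsym ring_language) (fun i : 'I_2 =>
    if i == ord0 then
      App (f := Rmul : Defs.fsym ring_language)
        (fun j : 'I_2 => if j == ord0 then var 2%N else var 0%N)
    else var 3%N))), (fun=> 0%R).
  by [].
have [p [S [_ [r [phi [c0 hphi]]] htr]]] := hM 4 R isT defR.
(* The four coordinates of [R] are (x, y, a, b): the first two go to the point
   side, the last two and the parameters to the line side; the variables that are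
   left over on either side do not occur. *)
pose P := #|{: 'I_4 * 'I_p}|; pose Q := #|{: 'I_4 * 'I_p + 'I_r}|.
pose rho (z : 'I_4 * 'I_p + 'I_r) : ('I_P + 'I_Q)%type :=
  match z with
  | inl ij => if (ij.1 < 2)%N then inl (enum_rank ij) else inr (enum_rank z)
  | inr l => inr (enum_rank z)
  end.
have [c hc] := zarankiewicz_trace (rename rho phi : pformula L P Q) hT.
have [d [hd1 hd2]] := exists_exponent c.
have [X [B [B' [[uX uB uB'] sX hXB [B0 hB hB']]]]] := exists_small_doubling infD hd1.
have [f hf] := htr [set` X ++ B ++ B']%classic (finite_seq _).
have [m0] := carrier_nonempty M.
(* [F] extends [f] to all of [D], so that it applies to the filler [0] of the coordinates that do
   not occur. *)
pose F (x : D) : 'I_p -> M :=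
  if insub x is Some u then f u else fun=> m0.
pose quad (x y a b : D) (i : 'I_4) : D := nth 0%R [:: x; y; a; b] i.
have FS (x y a b : D) : x \in X -> y \in B' -> a \in X -> b \in B ->
    S (fun i => F (quad x y a b i)) <-> y = (a * x + b)%R.
  move=> xX yB' aX bB.
  have qA i : quad x y a b i \in [set` X ++ B ++ B']%classic.
    apply/mem_set; rewrite /= !mem_cat /quad.
    by case: i => -[|[|[|[|//]]]] _ /=; rewrite ?xX ?yB' ?aX ?bB ?orbT.
  have := hf (fun i => SigSub (qA i)).
  rewrite /R /= /quad !inordK //= => ->.
  suff -> : (fun i => F (quad x y a b i)) = (fun i => f (SigSub (qA i))) by [].
  apply/funext => i; rewrite /F; case: insubP => [v _ vE|]; last by rewrite qA.
  by congr f; apply: val_inj.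
pose alpha (u : seq_sub X * seq_sub B') (k : 'I_P) : M :=
  F (quad (val u.1) (val u.2) 0%R 0%R (enum_val k).1) (enum_val k).2.
pose beta (u : seq_sub X * seq_sub B) (k : 'I_Q) : M :=
  match enum_val k with
  | inl ij => F (quad 0%R 0%R (val u.1) (val u.2) ij.1) ij.2
  | inr l => c0 l
  end.
have trE u l : trace (rename rho phi) alpha beta u l = point_line u l.
  pose w (ij : 'I_4 * 'I_p) := F (quad (val u.1) (val u.2) (val l.1) (val l.2) ij.1) ij.2.
  have wE : join (alpha u) (beta l) \o rho = join w c0.
    apply/funext => -[[i j]|k] /=; rewrite /alpha /beta /w ?enum_rankK //=.
    by case: i => -[|[|[|[|//]]]] hi /=; rewrite enum_rankK.
  have phiE : psat phi w c0 =
      S (fun i => F (quad (val u.1) (val u.2) (val l.1) (val l.2) i)).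
    by rewrite -[LHS]/([set a | psat phi a c0]%classic w) -hphi.
  have uvE := FS _ _ _ _ (valP u.1) (valP u.2) (valP l.1) (valP l.2).
  apply/asboolP/eqP; rewrite /psat sat_rename wE -/(psat phi w c0) phiE uvE //.
(* There are at most [3 * 2 ^ d * size B] vertices, and [size B] is at most [2 ^ d ^ 3]; the summand
   2 absorbs the factor 3. *)
pose m := (d ^ 3 + d + 2)%N.
have cA : #|{: seq_sub X * seq_sub B'}| + #|{: seq_sub X * seq_sub B}|
    <= 2 ^ d * (3 * size B).
  rewrite !card_prod !card_seq_sub // sX -mulnDr leq_mul2l mulSn addnC.
  by rewrite leq_add2l hB' orbT.
have hm : #|{: seq_sub X * seq_sub B'}| + #|{: seq_sub X * seq_sub B}| < 2 ^ m.
  apply: leq_ltn_trans cA _; rewrite /m !expnD.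
  by have := expn_gt0 2 d; have := expn_gt0 2 (d ^ 3); nia.
have hK := hc M MT _ _ alpha beta m 2 hm.
have {}hK := hK (fun Y Z cY cZ h => point_line_K22_free cY cZ (fun u l uY lZ =>
  eq_ind _ is_true (h u l uY lZ) _ (trE u l))).
have := leq_trans (leq_card_point_line uX uB hXB) (leq_trans _ hK).
rewrite (_ : [set e | point_line e.1 e.2]%SET =
  [set e | trace (rename rho phi) alpha beta e.1 e.2]%SET); last first.
  by apply/setP => e; rewrite !inE trE.
move=> /(_ (leqnn _)) hle.
(* Divided by [2 ^ d * size B], this bounds [2 ^ d] by [6 * m.+2 ^ c], contrary to the choice of
   [d]. *)
have {hle} : 2 ^ d * 2 ^ d * size B <= m.+2 ^ c * 2 * (2 ^ d * (3 * size B)).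
  by rewrite -sX; apply: leq_trans hle _; rewrite sX leq_mul2l cA orbT.
apply/negP; rewrite -ltnNge.
have -> : m.+2 = d ^ 3 + d + 4 by rewrite /m; lia.
set y := _ ^ c in hd2 *.
have -> : y * 2 * (2 ^ d * (3 * size B)) = 6 * y * (2 ^ d * size B) by nia.
by rewrite -[ltnRHS]mulnA ltn_pmul2r // muln_gt0 expn_gt0.
Qed.

Theorem corollary1p2 (R : realType) (L : language) (T : theory L)
    (hT : one_semi_equational T) :
  almost_linear_zarankiewicz R T /\
  (forall D : idomainType, infinite_set [set: D] ->
     ~ locally_trace_defines T (ring_structure D)).
Proof.
split; first exact: almost_linear_zarankiewicz_one_semi_equational.
by move=> D; apply: no_locally_trace_defines.
Qed.
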